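(* Let $d\ge 2$ and $\omega>2$ be fixed integers independent of $n$. There is a polynomial time approximation scheme for the Maximum Independent Set problem in $d$-dimensional Line of Sight networks with range parameter $\omega$ (presented with their embedding in $\mathbb{Z}^d_n$): for every fixed $\epsilon>0$ there is an algorithm running in time polynomial in $n$ that, on any such network, returns a $(1+\epsilon)$-approximation.
   Context: $\mathbb{Z}^d_n=\{1,\dots,n\}^d$. Two distinct points share a line of sight if their coordinates differ in exactly one place. A vertex-weighted graph $G=(V,E,w)$ (positive weights) is a $d$-dimensional Line of Sight (LoS) network with range parameter $\omega$ if there is an embedding (injective map) $f_G:V\to\mathbb{Z}^d_n$ such that $\{u,v\}\in E$ if and only if $f_G(u)$ and $f_G(v)$ share a line of sight and their Manhattan distance is less than $\omega$. The Maximum Independent Set (MIS) problem asks for an independent set maximizing the sum of the weights of its elements. A $(1+\epsilon)$-approximation is an independent set whose total weight is at least $1/(1+\epsilon)$ times the optimum. *)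

(* Defs.v *)
From HB Require Import structures.
From mathcomp Require Import all_boot all_order all_algebra.
From mathcomp Require Import reals.

Set Implicit Arguments.
Unset Strict Implicit.
Unset Printing Implicit Defensive.

Import Order.TTheory GRing.Theory Num.Theory.

Local Open Scope ring_scope.

Record wgraph (R : realType) := WGraph {
  nvert : nat;
  edge : rel 'I_nvert;
  weight : 'I_nvert -> R;
  edge_sym : symmetric edge;
  edge_irrefl : irreflexive edge;
  weight_gt0 : forall v, 0 < weight v }.

Section IndependentSets.
Variables (R : realType) (G : wgraph R).

Definition independent (S : {set 'I_(nvert G)}) : bool :=
  [forall u in S, forall v in S, ~~ edge u v].

Definition set_weight (S : {set 'I_(nvert G)}) : R :=
  \sum_(v in S) weight v.

(* The initial value 0 of the maximum is the weight of the independent set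
   [set0], and all weights are positive. *)
Definition mis_weight : R :=
  \big[Order.max/0]_(S : {set 'I_(nvert G)} | independent S) set_weight S.

Definition mis_approx (eps : R) (S : {set 'I_(nvert G)}) : Prop :=
  independent S /\ (1 / (1 + eps)) * mis_weight <= set_weight S.

End IndependentSets.

Section LineOfSight.
Variable d : nat.

Definition point := {ffun 'I_d -> nat}.

Definition in_grid (n : nat) (x : point) : bool :=
  [forall j, 1 <= x j <= n]%N.

Definition line_of_sight (x y : point) : bool :=
  #|[set j | x j != y j]| == 1%N.

Definition manhattan (x y : point) : nat :=
  (\sum_(j < d) `|x j - y j|)%N.

Definition los_embedding (R : realType) (n omega : nat) (G : wgraph R)
    (f : 'I_(nvert G) -> point) : Prop :=
  [/\ injective f,
      forall v, in_grid n (f v) &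
      forall u v, edge u v =
        line_of_sight (f u) (f v) && (manhattan (f u) (f v) < omega)%N].

End LineOfSight.

(* Model of computation: structured programs for a random access machine with
   two kinds of cells, holding natural numbers and weights.  A cell is addressed
   by an array name, which is a literal of the program, and a computed index.
   The only operations are addition, subtraction and comparison, with no
   multiplication, and 0 is the only weight constant.  With these operations,
   after t steps every natural number in memory has O(t) more bits than those
   of the input and the program, and every weight in memory is an integer
   combination of input weights whose coefficients have O(t) bits.  Hence, on
   rational weights, a Turing machine simulates t steps in time polynomial in t
   and the bit length of the input. *)

Inductive nexp : Type :=
  | NConst of nat
  | NLoad of nat & nexp
  | NAdd of nexp & nexp
  | NSub of nexp & nexp.

Inductive wexp : Type :=
  | WZero
  | WLoad of nat & nexp
  | WAdd of wexp & wexp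
  | WSub of wexp & wexp.

Inductive bexp : Type :=
  | BNle of nexp & nexp
  | BWle of wexp & wexp
  | BNot of bexp
  | BAnd of bexp & bexp.

Inductive cmd : Type :=
  | Skip
  | NStore of nat & nexp & nexp
  | WStore of nat & nexp & wexp
  | Seq of cmd & cmd
  | If of bexp & cmd & cmd
  | While of bexp & cmd.

Section Semantics.
Variable R : realType.

Record state := State {
  nmem : nat -> nat -> nat;
  wmem : nat -> nat -> R }.

Definition update (T : Type) (M : nat -> nat -> T) (a i : nat) (x : T) :
    nat -> nat -> T :=
  fun b j => if (b == a) && (j == i) then x else M b j.

Fixpoint neval (s : state) (e : nexp) : nat :=
  match e with
  | NConst k => k
  | NLoad a i => nmem s a (neval s i)
  | NAdd e1 e2 => (neval s e1 + neval s e2)%N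
  | NSub e1 e2 => (neval s e1 - neval s e2)%N
  end.

Fixpoint weval (s : state) (e : wexp) : R :=
  match e with
  | WZero => 0
  | WLoad a i => wmem s a (neval s i)
  | WAdd e1 e2 => weval s e1 + weval s e2
  | WSub e1 e2 => weval s e1 - weval s e2
  end.

Fixpoint beval (s : state) (b : bexp) : bool :=
  match b with
  | BNle e1 e2 => (neval s e1 <= neval s e2)%N
  | BWle e1 e2 => weval s e1 <= weval s e2
  | BNot b1 => ~~ beval s b1
  | BAnd b1 b2 => beval s b1 && beval s b2
  end.

(* [exec c s t s']: started in [s], [c] halts in [s'] after [t] steps.  The
   size of an expression is bounded by a constant of the program, so evaluating
   one is charged a single step. *)
Inductive exec : cmd -> state -> nat -> state -> Prop :=
  | ExecSkip s : exec Skip s 1 s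
  | ExecNStore s a i e :
      exec (NStore a i e) s 1
        (State (update (nmem s) a (neval s i) (neval s e)) (wmem s))
  | ExecWStore s a i e :
      exec (WStore a i e) s 1
        (State (nmem s) (update (wmem s) a (neval s i) (weval s e)))
  | ExecSeq c1 c2 s s1 s2 t1 t2 :
      exec c1 s t1 s1 -> exec c2 s1 t2 s2 ->
      exec (Seq c1 c2) s (t1 + t2)%N s2
  | ExecIf b c1 c2 s s' t :
      exec (if beval s b then c1 else c2) s t s' ->
      exec (If b c1 c2) s t.+1 s'
  | ExecWhileDone b c s :
      ~~ beval s b -> exec (While b c) s 1 s
  | ExecWhileStep b c s s1 s2 t1 t2 :
      beval s b -> exec c s t1 s1 -> exec (While b c) s1 t2 s2 ->
      exec (While b c) s (t1 + t2).+1 s2.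

Lemma exec_det c s t s1 t' s2 :
  exec c s t s1 -> exec c s t' s2 -> t = t' /\ s1 = s2.
Proof.
move=> H; elim: H t' s2 => {c s t s1};
  try by move=> *; match goal with H : exec _ _ _ _ |- _ => inversion H end.
- move=> c1 c2 s sa sb t1 t2 _ IH1 _ IH2 t' s2 H.
  inversion H as [| | |? ? ? s1' ? ? ? e1 e2| | |]; subst.
  by have [? ?] := IH1 _ _ e1; subst; have [? ?] := IH2 _ _ e2; subst.
- move=> b c1 c2 s s' t _ IH t' s2 H.
  inversion H as [| | | |? ? ? ? ? ? e1| |]; subst.
  by have [? ?] := IH _ _ e1; subst.
- move=> b c s nb t' s2 H.
  inversion H as [| | | | | |? ? ? ? ? ? ? hb]; subst => //.
  by rewrite hb in nb.
- move=> b c s sa sb t1 t2 hb _ IH1 _ IH2 t' s2 H.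
  inversion H as [| | | | |? ? ? nb|? ? ? ? ? ? ? ? e1 e2]; subst.
    by rewrite hb in nb.
  by have [? ?] := IH1 _ _ e1; subst; have [? ?] := IH2 _ _ e2; subst.
Qed.

Variables (d n : nat) (G : wgraph R) (f : 'I_(nvert G) -> point d).

(* Array 0 of natural numbers is initially zero and receives the output; array 1
   contains n and the number of vertices; array j + 2 contains the coordinate of
   index j of every vertex.  Array 0 of weights contains the vertex weights.
   All other cells are zero. *)
Definition input_nmem (a i : nat) : nat :=
  match a with
  | 0 => 0%N
  | 1 => match i with 0 => n | 1 => nvert G | _ => 0%N end
  | j.+2 => if (insub j : option 'I_d, insub i : option 'I_(nvert G))
              is (Some j', Some v) then f v j' else 0%N
  end.

Definition input_wmem (a i : nat) : R :=
  match a with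
  | 0 => if insub i : option 'I_(nvert G) is Some v then weight v else 0
  | _ => 0
  end.

Definition input_state : state := State input_nmem input_wmem.

End Semantics.

Definition output_set (R : realType) (G : wgraph R) (s : state R) :
    {set 'I_(nvert G)} :=
  [set v : 'I_(nvert G) | nmem s 0 v != 0%N].

(* Main.v *)
Require Import Defs.
From mathcomp Require Import all_boot all_order all_algebra.
From mathcomp Require Import reals.
From mathcomp Require Import zify lra.

Set Implicit Arguments.
Unset Strict Implicit.
Unset Printing Implicit Defensive.

Import Order.TTheory GRing.Theory Num.Theory.

Local Open Scope ring_scope.

(** Shift the grid by s, cut it into cubes of side k, and delete the vertices
whose offset in their cube is less than omega in some coordinate.  An edge
joining two kept vertices stays inside a cube, and a cube holds at most k^d
vertices, so the kept subgraph is solved exactly by trying in every cube all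
choices of k^d vertices: replacing the part of the current independent set in
that cube whenever this increases the total weight never decreases the weight
in any cube.  Each vertex is deleted for at most d*omega of the k shifts, so
by averaging the best shift retains a fraction 1 - d*omega/k of the optimum.

The time bound comes for free from the shape of the program: the number of
nested loops is a constant, and each of them runs at most n^d + n + 1 times. *)

(** * Program logic *)

Definition var (x : nat) : nexp := NLoad x (NConst 0).
Definition blt (e1 e2 : nexp) : bexp := BNot (BNle e2 e1).
Definition beq (e1 e2 : nexp) : bexp := BAnd (BNle e1 e2) (BNle e2 e1).
Definition bfalse : bexp := blt (NConst 0) (NConst 0).
Definition bor (b1 b2 : bexp) : bexp := BNot (BAnd (BNot b1) (BNot b2)).
Definition member (a : nat) (e : nexp) : bexp := blt (NConst 0) (NLoad a e).

Definition for_loop (x : nat) (e : nexp) (c : cmd) : cmd :=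
  Seq (NStore x (NConst 0) (NConst 0))
    (While (blt (var x) e)
      (Seq c (NStore x (NConst 0) (NAdd (var x) (NConst 1))))).

Fixpoint nwrites (c : cmd) : seq nat :=
  match c with
  | NStore a _ _ => [:: a]
  | Seq c1 c2 | If _ c1 c2 => nwrites c1 ++ nwrites c2
  | While _ c1 => nwrites c1
  | _ => [::]
  end.

Fixpoint wwrites (c : cmd) : seq nat :=
  match c with
  | WStore a _ _ => [:: a]
  | Seq c1 c2 | If _ c1 c2 => wwrites c1 ++ wwrites c2
  | While _ c1 => wwrites c1
  | _ => [::]
  end.

(** Computed from the program text alone: every [While] is charged [B] turns, and the polynomial is
    later evaluated at [n]. *)
Fixpoint time_bound (B : {poly nat}) (c : cmd) : {poly nat} :=
  match c with
  | Seq c1 c2 => time_bound B c1 + time_bound B c2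
  | If _ c1 c2 => 1 + (time_bound B c1 + time_bound B c2)
  | While _ c1 => 1 + B * (1 + time_bound B c1)
  | _ => 1
  end.

Section ProgramLogic.
Variable R : realType.
Implicit Types (s : state R) (c : cmd) (Q : state R -> Prop).

Definition nset x i y s : state R := State (update (nmem s) x i y) (wmem s).

Lemma nset_neq x i y s a j :
  (a != x) -> nmem (nset x i y s) a j = nmem s a j.
Proof. by rewrite /= /update => /negPf ->. Qed.

Lemma nset_eq x i y s : nmem (nset x i y s) x i = y.
Proof. by rewrite /= /update !eqxx. Qed.

(** The write sets are syntactic, so which arrays survive a command is read off its text, and
    invariants only mention what changes. *)
Definition frame c s s' : Prop :=
  (forall a i, a \notin nwrites c -> nmem s' a i = nmem s a i) /\
  (forall a i, a \notin wwrites c -> wmem s' a i = wmem s a i).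

Lemma frame_trans c s1 s2 s3 : frame c s1 s2 -> frame c s2 s3 -> frame c s1 s3.
Proof.
by move=> [n1 w1] [n2 w2]; split=> a i ha; rewrite (n2, w2) // (n1, w1).
Qed.

Lemma frame_sub c1 c2 s s' :
  {subset nwrites c1 <= nwrites c2} -> {subset wwrites c1 <= wwrites c2} ->
  frame c1 s s' -> frame c2 s s'.
Proof.
move=> hn hw [n1 w1]; split=> a i ha; rewrite (n1, w1) //.
  exact: contra (hn a) ha.
exact: contra (hw a) ha.
Qed.

Lemma frame_catl c1 c2 s s' : frame c1 s s' -> frame (Seq c1 c2) s s'.
Proof. by apply: frame_sub => a /=; rewrite mem_cat => ->. Qed.

Lemma frame_catr c1 c2 s s' : frame c2 s s' -> frame (Seq c1 c2) s s'.
Proof. by apply: frame_sub => a /=; rewrite mem_cat => ->; rewrite orbT. Qed.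

Lemma exec_frame c s t s' : exec c s t s' -> frame c s s'.
Proof.
elim=> {c s t s'} //.
- move=> s a i e; split=> // b j; rewrite inE => hb; exact: nset_neq.
- by move=> s a i e; split=> // b j; rewrite inE /= /update => /negPf ->.
- move=> c1 c2 s s1 s2 t1 t2 _ f1 _ f2.
  exact: frame_trans (frame_catl _ f1) (frame_catr _ f2).
- move=> b c1 c2 s s' t _; case: (beval s b) => h.
    exact: (@frame_catl c1 c2).
  exact: (@frame_catr c1 c2).
- by move=> b c s s1 s2 t1 t2 _ _ f1 _; apply: frame_trans.
Qed.

Variables (B : {poly nat}) (n : nat).

(** Total correctness with a cost: termination, time bound and postcondition travel together through
    the rules below. *)
Definition wp c Q s : Prop :=
  exists t s', [/\ exec c s t s', (t <= (time_bound B c).[n])%N & Q s'].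

Lemma wp_imp c P Q s :
  wp c P s -> (forall s', frame c s s' -> P s' -> Q s') -> wp c Q s.
Proof.
move=> [t [s' [h ht hP]]] hPQ; exists t, s'; split=> //.
exact: hPQ (exec_frame h) hP.
Qed.

Lemma wp_skip Q s : Q s -> wp Skip Q s.
Proof. by move=> h; exists 1%N, s; split=> //; [constructor | rewrite hornerC]. Qed.

Lemma wp_nstore a i e Q s :
  Q (nset a (neval s i) (neval s e) s) -> wp (NStore a i e) Q s.
Proof.
by move=> h; eexists 1%N, _; split; [constructor | rewrite hornerC | exact: h].
Qed.

Lemma wp_wstore a i e Q s :
  Q (State (nmem s) (update (wmem s) a (neval s i) (weval s e))) ->
  wp (WStore a i e) Q s.
Proof.
by move=> h; eexists 1%N, _; split; [constructor | rewrite hornerC | exact: h].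
Qed.

Lemma wp_seq c1 c2 P Q s :
  wp c1 P s -> (forall s', frame c1 s s' -> P s' -> wp c2 Q s') ->
  wp (Seq c1 c2) Q s.
Proof.
move=> [t1 [s1 [h1 ht1 hP]]] h2.
have [t2 [s2 [h2' ht2 hQ]]] := h2 _ (exec_frame h1) hP.
exists (t1 + t2)%N, s2; split=> //; first exact: ExecSeq h1 h2'.
by rewrite hornerD leq_add.
Qed.

Lemma wp_if b c1 c2 Q s :
  (beval s b -> wp c1 Q s) -> (~~ beval s b -> wp c2 Q s) ->
  wp (If b c1 c2) Q s.
Proof.
move=> h1 h2.
suff [t [s' [h ht hQ]]] : exists t s', [/\ exec (if beval s b then c1 else c2) s t s',
    (t <= (time_bound B c1).[n] + (time_bound B c2).[n])%N & Q s'].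
  exists t.+1, s'; split=> //; first exact: ExecIf.
  by rewrite /= !hornerD hornerC ltnS.
case hb: (beval s b).
  have [t [s' [? ht ?]]] := h1 hb; exists t, s'; split=> //.
  exact: leq_trans ht (leq_addr _ _).
have [t [s' [? ht ?]]] := h2 (negbT hb); exists t, s'; split=> //.
exact: leq_trans ht (leq_addl _ _).
Qed.

Lemma wp_while b c (I : nat -> state R -> Prop) m s :
  (m <= B.[n])%N -> I 0%N s ->
  (forall i s', (i < m)%N -> I i s' -> beval s' b /\ wp c (I i.+1) s') ->
  (forall s', I m s' -> ~~ beval s' b) ->
  wp (While b c) (I m) s.
Proof.
move=> hm hI hstep hend; set T := (time_bound B c).[n].
(* Induction on the number [j] of remaining turns: each costs at most [T] plus one, and the final
   failing guard costs one more. *)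
have run j i s' : (i + j = m)%N -> I i s' ->
    exists t s'', [/\ exec (While b c) s' t s'', (t <= 1 + j * T.+1)%N & I m s''].
  elim: j i s' => [|j IH] i s'.
    rewrite addn0 => -> hs; exists 1%N, s'; split=> //.
    exact: ExecWhileDone (hend _ hs).
  rewrite addnS -addSn => hij hs.
  have hi : (i < m)%N by rewrite -hij leq_addr.
  have [hb [t1 [s1 [h1 ht1 hI1]]]] := hstep _ _ hi hs.
  have [t2 [s2 [h2 ht2 hI2]]] := IH _ _ hij hI1.
  exists (t1 + t2).+1, s2; split=> //; first exact: ExecWhileStep hb h1 h2.
  by rewrite -/T in ht1; rewrite mulSn; move: (j * _)%N ht2 => x; lia.
have [t [s' [h ht hs]]] := run m 0%N s (add0n m) hI.
exists t, s'; split=> //; apply: leq_trans ht _.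
rewrite /= hornerD hornerM hornerD !hornerC -/T.
rewrite leq_add2l; exact: leq_mul.
Qed.

(** The loop itself writes the counter, so [I] has to be insensitive to it. The bound [e] is
    evaluated anew at each turn; the frame is what keeps it equal to [m]. *)
Lemma wp_for x e c m (I : nat -> state R -> Prop) s :
  x \notin nwrites c -> (m <= B.[n])%N ->
  (forall s', frame (for_loop x e c) s s' -> neval s' e = m) ->
  (forall i y s', I i s' -> I i (nset x 0 y s')) ->
  I 0%N s ->
  (forall i s', (i < m)%N -> frame (for_loop x e c) s s' ->
     nmem s' x 0 = i -> I i s' -> wp c (I i.+1) s') ->
  wp (for_loop x e c) (I m) s.
Proof.
move=> hx hm he hset h0 hstep.
pose F := frame (for_loop x e c) s.
have hsetF y s' : F s' -> F (nset x 0 y s').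
  move=> h; apply: frame_trans h _; split=> // a i.
  rewrite /= inE negb_or => /andP[ha _]; exact: nset_neq.
apply: (@wp_seq _ _ (fun s' => [/\ F s', nmem s' x 0 = 0%N & I 0%N s'])).
  by apply: wp_nstore; split; [exact: hsetF | exact: nset_eq | exact: hset].
move=> s1 _ h1.
apply: (@wp_imp _ (fun s' => [/\ F s', nmem s' x 0 = m & I m s'])); last first.
  by move=> ? _ [].
pose J i s' := [/\ F s', nmem s' x 0 = i & I i s'].
apply: (@wp_while _ _ J m s1 hm h1).
- move=> i s2 hi [h2 hxi hI]; split.
    by rewrite /= (he _ h2) hxi -ltnNge.
  apply: wp_seq (hstep _ _ hi h2 hxi hI) _ => s3 h3 hI3.
  have hF3 : F s3.
    apply: frame_trans h2 _; apply: frame_sub h3 => a /=; rewrite ?inE ?mem_cat => ->.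
      by rewrite orbT.
    by rewrite ?orbT.
  apply: wp_nstore; split; [exact: hsetF | | exact: hset].
  by rewrite nset_eq /= (proj1 h3) // hxi addn1.
- by move=> s2 [h2 hxm _] /=; rewrite (he _ h2) hxm leqnn.
Qed.

End ProgramLogic.

(** * Independent sets and shifted boxes *)

Section Weights.
Variables (R : realType) (G : wgraph R).
Implicit Types A S T : {set 'I_(nvert G)}.

Lemma independentP S :
  reflect {in S &, forall u v, ~~ edge u v} (independent S).
Proof.
apply: (iffP forallP) => [h u v hu hv | h u].
  by have /implyP/(_ hu)/forallP/(_ v)/implyP/(_ hv) := h u.
by apply/implyP => hu; apply/forallP => v; apply/implyP; apply: h.
Qed.

Lemma independent_sub S T : S \subset T -> independent T -> independent S.
Proof.
move=> /subsetP sub /independentP h; apply/independentP => u v hu hv.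
by apply: h; apply: sub.
Qed.

Lemma independent0 : independent (set0 : {set 'I_(nvert G)}).
Proof. by apply/independentP => u v; rewrite inE. Qed.

Lemma set_weight_ge0 S : 0 <= set_weight S.
Proof. by apply: sumr_ge0 => v _; apply/ltW/weight_gt0. Qed.

Lemma set_weight_setID A S :
  set_weight S = set_weight (S :&: A) + set_weight (S :\: A).
Proof. exact: big_setID. Qed.

(** Independence of [S] is tested rather than assumed, because the search tries arbitrary choices of
    vertices. *)
Definition heavier S T := independent S && (set_weight T < set_weight S).

Definition improve S T := if heavier S T then S else T.

Lemma improve_independent S T : independent T -> independent (improve S T).
Proof. by rewrite /improve /heavier; case: ifP => // /andP[]. Qed.

Lemma improve_geT S T : set_weight T <= set_weight (improve S T).
Proof. by rewrite /improve /heavier; case: ifP => // /andP[_ /ltW]. Qed.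

Lemma improve_geS S T : independent S -> set_weight S <= set_weight (improve S T).
Proof.
by rewrite /improve /heavier => ->; case: (ltrP (set_weight T)).
Qed.

End Weights.

(** * Shifted boxes and exchanges inside one box *)

Section Boxes.
Variables (R : realType) (d n omega : nat) (G : wgraph R).
Variable f : 'I_(nvert G) -> point d.
Hypothesis los : los_embedding n omega f.
Variables k s : nat.
Hypothesis k_gt0 : (0 < k)%N.
Implicit Types (S D X : {set 'I_(nvert G)}) (q : point d).

Definition kept : {set 'I_(nvert G)} :=
  [set v | [forall j, (omega <= (f v j + s) %% k)%N]].

Definition block (v : 'I_(nvert G)) : point d := [ffun j => (f v j + s) %/ k]%N.

Definition box q : {set 'I_(nvert G)} := [set v in kept | block v == q].

(** If the quotients differed in some coordinate, the larger value, with remainder at least [omega],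
    would exceed the other, with remainder below [k], by more than [omega]; an edge moves each
    coordinate by less than [omega]. *)
Lemma edge_block u v : u \in kept -> v \in kept -> edge u v -> block u = block v.
Proof.
case: los => _ _ ->; rewrite !inE => /forallP hu /forallP hv /andP[_ hm].
apply/ffunP => j; rewrite !ffunE.
have hj : (`|f u j - f v j| < omega)%N.
  by apply: leq_ltn_trans hm; rewrite /manhattan (bigD1 j) //= leq_addr.
move: hj (hu j) (hv j) (divn_eq (f u j + s) k) (divn_eq (f v j + s) k).
have := ltn_pmod (f u j + s) k_gt0; have := ltn_pmod (f v j + s) k_gt0.
move: (_ %/ k)%N (_ %/ k)%N (_ %% k)%N (_ %% k)%N => q1 q2 r1 r2.
by move=> *; nia.
Qed.

(** Inside a box, a vertex is determined by the remainders of its shifted coordinates modulo [k]. *)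
Lemma box_card q : (#|box q| <= k ^ d)%N.
Proof.
pose g v : {ffun 'I_d -> 'I_k} :=
  [ffun j => Ordinal (ltn_pmod (f v j + s) k_gt0)].
have inj : {in box q &, injective g}.
  move=> u v; rewrite !inE => /andP[_ /eqP hu] /andP[_ /eqP hv] hg.
  case: los => f_inj _ _; apply: f_inj; apply/ffunP => j.
  have := congr1 (fun h : {ffun _ -> _} => val (h j)) hg.
  have := congr1 (fun h : point d => h j) (etrans hu (esym hv)).
  rewrite !ffunE /= => e1 e2; apply: (@addIn s).
  by rewrite (divn_eq (f u j + s) k) e1 e2 -divn_eq.
rewrite -(card_in_imset inj); apply: leq_trans (max_card _) _.
by rewrite card_ffun !card_ord.
Qed.

Definition exchange q S D := (D :\: box q) :|: (S :&: box q).

Lemma exchange_sub q S D : D \subset kept -> exchange q S D \subset kept.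
Proof.
move=> hD; rewrite subUset (subset_trans (subsetDl _ _) hD) /=.
by apply: subset_trans (subsetIr _ _) _; apply/subsetP => v; rewrite !inE => /andP[].
Qed.

(** By [edge_block], an edge between the old and the new part would put its old endpoint into the
    box as well. *)
Lemma exchange_independent q S D :
  D \subset kept -> independent D -> independent (S :&: box q) ->
  independent (exchange q S D).
Proof.
move=> hD /independentP iD /independentP iS.
have kD v : v \in D -> v \in kept by apply: (subsetP hD).
have kB v : v \in box q -> v \in kept by rewrite !inE => /andP[].
have cross u v : u \in D :\: box q -> v \in S :&: box q -> edge u v = false.
  rewrite in_setD in_setI => /andP[nu uD] /andP[_ vB].
  apply: contraNF nu => e; rewrite inE (edge_block (kD _ uD) (kB _ vB) e) kD //.
  by move: vB; rewrite inE => /andP[].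
apply/independentP => u v /setUP[hu|hu] /setUP[hv|hv].
- by apply: iD; [move: hu | move: hv]; rewrite in_setD => /andP[].
- by rewrite cross.
- by rewrite edge_sym cross.
- exact: iS.
Qed.

Lemma box_disjoint q q' : q != q' -> [disjoint box q & box q'].
Proof.
move=> hq; apply/pred0P => v /=; rewrite !inE.
by case: eqP => [->|]; rewrite ?andbF //= (negPf hq) !andbF.
Qed.

Lemma exchange_box q S D : exchange q S D :&: box q = S :&: box q.
Proof.
apply/setP => v; rewrite !in_setI in_setU in_setD in_setI.
by case: (v \in box q); rewrite ?andbF //= !andbT.
Qed.

Lemma exchange_out q S D : exchange q S D :\: box q = D :\: box q.
Proof.
apply/setP => v; rewrite !in_setD in_setU in_setD in_setI.
by case: (v \in box q); rewrite ?andbF ?orbF.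
Qed.

(** Comparing box by box, and not only in total, ensures that what is reached in one box survives
    later exchanges in the others. *)
Definition boxwise_le D X :=
  forall q, set_weight (D :&: box q) <= set_weight (X :&: box q).

(** An accepted exchange raises the total weight and leaves everything outside the box [q]
    unchanged, so the gain lies in [q]. *)
Lemma boxwise_improve q S D :
  boxwise_le D (improve (exchange q S D) D).
Proof.
rewrite /improve; case: ifP => [/andP[_ hw] p | _ p //].
have [-> | hp] := eqVneq p q.
  move: hw; rewrite (set_weight_setID (box q)) [X in _ < X](set_weight_setID (box q)).
  by rewrite exchange_out ltrD2r => /ltW.
suff -> : exchange q S D :&: box p = D :&: box p by [].
apply/setP => v; rewrite !in_setI in_setU in_setD in_setI.
have /pred0P/(_ v)/= := box_disjoint hp.
by case: (v \in box p); case: (v \in box q); rewrite ?andbF ?orbF.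
Qed.

(** Outside the box both sets agree, so if the exchange is rejected, [D] was already at least as
    heavy inside it. *)
Lemma improve_box q S D :
  D \subset kept -> independent D -> independent (S :&: box q) ->
  set_weight (S :&: box q) <= set_weight (improve (exchange q S D) D :&: box q).
Proof.
move=> kD iD iS; rewrite /improve /heavier exchange_independent //=.
case: ltrP => hw; first by rewrite exchange_box.
move: hw; rewrite (set_weight_setID (box q)) [X in _ <= X](set_weight_setID (box q)).
by rewrite exchange_out lerD2r exchange_box.
Qed.

(** As [f v j + s] is at most [n + k - 1], box indices run from 0 to [n]; hence the [n + 1] in
    [loop_bound]. *)
Lemma block_le v j : (s < k)%N -> (block v j < n.+1)%N.
Proof.
move=> sk; case: los => _ /(_ v)/forallP/(_ j)/andP[_ h] _.
rewrite ffunE ltn_divLR // mulSn addnC; rewrite -addSn leq_add //.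
by apply: leq_trans h _; rewrite leq_pmulr.
Qed.

Lemma set_weight_boxes D : (s < k)%N -> D \subset kept ->
  set_weight D = \sum_(q : {ffun 'I_d -> 'I_n.+1})
                    set_weight (D :&: box [ffun j => val (q j)]).
Proof.
move=> sk kD.
pose g v : {ffun 'I_d -> 'I_n.+1} := [ffun j => inord (block v j)].
rewrite /set_weight (partition_big g xpredT) //=; apply: eq_bigr => q _.
apply: eq_bigl => v; rewrite in_setI in_set; case vD: (v \in D) => //=.
rewrite (subsetP kD) //=; apply/eqP/eqP => [<- | h].
  by apply/ffunP => j; rewrite [RHS]ffunE [in RHS]ffunE /= inordK ?block_le.
by apply/ffunP => j; rewrite ffunE h ffunE; apply: val_inj; rewrite /= inordK.
Qed.

Lemma boxwise_le_weight D X : (s < k)%N -> D \subset kept -> X \subset kept ->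
  boxwise_le D X -> set_weight D <= set_weight X.
Proof.
by move=> sk kD kX h; rewrite !set_weight_boxes //; apply: ler_sum => q _.
Qed.

End Boxes.

(** * Averaging over the shifts *)

Section Shifting.
Variables (R : realType) (d n omega : nat) (G : wgraph R).
Variable f : 'I_(nvert G) -> point d.
Hypothesis los : los_embedding n omega f.
Variable k : nat.
Hypothesis k_gt0 : (0 < k)%N.
Implicit Types S T : {set 'I_(nvert G)}.

Lemma nvert_le : (nvert G <= n ^ d)%N.
Proof.
case: los => f_inj grid _.
(* Coordinates start at 1, so their predecessors range over ['I_n]. *)
have hlt v j : ((f v j).-1 < n)%N.
  by have /forallP/(_ j)/andP[] := grid v; case: (f v j).
pose g v : {ffun 'I_d -> 'I_n} := [ffun j => Ordinal (hlt v j)].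
have inj : injective g.
  move=> u v hg; apply: f_inj; apply/ffunP => j.
  have := congr1 (fun h : {ffun _ -> _} => val (h j)) hg; rewrite !ffunE /=.
  have /forallP/(_ j)/andP[] := grid u; have /forallP/(_ j)/andP[] := grid v.
  by case: (f u j) (f v j) => [|a] [|b] //= _ _ _ _ ->.
rewrite -[nvert G]card_ord -(card_imset _ inj).
by apply: leq_trans (max_card _) _; rewrite card_ffun !card_ord.
Qed.

(** For [s] below [k], the residues [(x + s) %% k] are distinct, so the bad shifts inject into the
    numbers below [omega]. *)
Lemma count_residues x :
  (count (fun s => (x + s) %% k < omega)%N (iota 0 k) <= omega)%N.
Proof.
rewrite -size_filter -(size_map (fun s => (x + s) %% k)%N).
rewrite -[leqRHS](size_iota 0); apply: uniq_leq_size => [|r].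
  rewrite map_inj_in_uniq ?filter_uniq ?iota_uniq // => a b.
  rewrite !mem_filter !mem_iota !add0n => /and3P[_ _ ak] /and3P[_ _ bk].
  by move=> /eqP; rewrite eqn_modDl !modn_small // => /eqP.
by case/mapP => s; rewrite mem_filter => /andP[h _] ->; rewrite mem_iota.
Qed.

(** Union bound: a shift deletes [v] only if one of the [d] coordinates is bad, and [count_residues]
    handles each coordinate. *)
Lemma count_kept v :
  (k <= count (fun s => v \in kept omega f k s) (iota 0 k) + d * omega)%N.
Proof.
rewrite -{1}(size_iota 0 k) -(count_predC (fun s => v \in kept omega f k s)).
rewrite leq_add2l -sum1_count big_mkcond /=.
have -> : (d * omega = \sum_(j < d) omega)%N by rewrite sum_nat_const card_ord.
pose bad j s := ((f v j + s) %% k < omega)%N.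
apply: (@leq_trans (\sum_(j < d) count (bad j) (iota 0 k))%N); last first.
  by apply: leq_sum => j _; apply: count_residues.
under [leqRHS]eq_bigr do rewrite -sum1_count big_mkcond /=.
rewrite exchange_big /=; apply: leq_sum => s _; rewrite inE negb_forall.
case: existsP => // -[j]; rewrite -ltnNge => hj.
by rewrite (bigD1 j) //= /bad hj.
Qed.

(** Double counting: once the sums are exchanged, the weight of [v] in [S] appears once for every
    shift that keeps [v]. *)
Lemma weight_shifts S :
  (k%:R - (d * omega)%:R) * set_weight S
    <= \sum_(0 <= s < k) set_weight (S :&: kept omega f k s).
Proof.
rewrite /set_weight mulr_sumr.
under [leRHS]eq_bigr => s _.
  under eq_bigl do rewrite in_setI.
  rewrite big_mkcondr /=; over.
rewrite exchange_big /=; apply: ler_sum => v _.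
rewrite -big_mkcond /= big_const_seq iter_addr_0 -[leRHS]mulr_natl.
rewrite ler_wpM2r ?(ltW (weight_gt0 v)) // lerBlDr -natrD ler_nat.
by rewrite /index_iota subn0 count_kept.
Qed.

(** Averaging gives [(k - d * omega) * w(T) <= k * w(S)] for every independent [T], and the
    condition on [k] amounts to [1 - d * omega / k >= 1 / (1 + eps)]. *)
Lemma shifts_approx (eps : R) S : 0 < eps ->
  (d * omega)%:R * (1 + eps) <= k%:R * eps ->
  independent S ->
  (forall s T, (s < k)%N -> independent T ->
     set_weight (T :&: kept omega f k s) <= set_weight S) ->
  mis_approx eps S.
Proof.
move=> eps_gt0 hk iS hS; split=> //.
have e1 : 0 < 1 + eps by rewrite addr_gt0.
rewrite mul1r ler_pdivrMl //; apply: bigmax_le => [|T iT].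
  by rewrite mulr_ge0 ?set_weight_ge0 ?ltW.
have := weight_shifts T.
have : \sum_(0 <= s < k) set_weight (T :&: kept omega f k s)
    <= k%:R * set_weight S.
  rewrite -[k in k%:R]subn0 mulr_natl -sumr_const_nat.
  by rewrite !big_mkord; apply: ler_sum => s _; apply: hS.
move=> h1 /le_trans/(_ h1) {h1}; have := set_weight_ge0 T.
have : 0 < k%:R :> R by rewrite ltr0n.
move: (set_weight T) (set_weight S) hk => x y; set a := _%:R; set b := k%:R.
move=> hk b0 x0 h; rewrite -(ler_pM2l b0).
have h2 : (1 + eps) * ((b - a) * x) <= (1 + eps) * (b * y) by rewrite ler_pM2l.
have h3 : a * (1 + eps) * x <= b * eps * x by rewrite ler_wpM2r.
lra.
Qed.

End Shifting.

(** * The algorithm *)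

Definition bconj (bs : seq bexp) : bexp := foldr BAnd (BNot bfalse) bs.
Definition nsum (es : seq nexp) : nexp := foldr NAdd (NConst 0) es.
(** The machine has no multiplication; a constant factor is unrolled into a sum of constant size. *)
Definition nscale (k : nat) (e : nexp) : nexp := iter k (NAdd e) (NConst 0).
Definition ndist (e1 e2 : nexp) : nexp := NAdd (NSub e1 e2) (NSub e2 e1).
(* Subtraction is truncated: the value is 1 if [e] is positive, and 0 otherwise. *)
Definition npositive (e : nexp) : nexp := NSub (NConst 1) (NSub (NConst 1) e).

Definition nest (xs : seq nat) (e : nexp) (c : cmd) : cmd :=
  foldr (fun x => for_loop x e) c xs.

Section Code.
Variables d omega k : nat.

(** Arrays 2 to [d + 1] hold the input coordinates, so the working arrays start at [d + 2]. *)
Definition scratch (i : nat) : nat := (d + 2 + i)%N.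

Notation current := (scratch 0).
Notation candidate := (scratch 1).
Notation flag := (scratch 2).
Notation u := (scratch 3).
Notation v := (scratch 4).

Definition vertices : nexp := NLoad 1 (NConst 1).
(** One bound serves both kinds of search loop: a box index takes the values up to [n], a pick all
    vertices and one value that is no vertex. *)
Definition loop_bound : nexp :=
  NAdd vertices (NAdd (NLoad 1 (NConst 0)) (NConst 1)).

Definition coord (j : nat) (e : nexp) : nexp := NLoad j.+2 e.

(** One of the two truncated differences in [ndist] is always zero; a line of sight means exactly
    one positive coordinate distance. *)
Definition edge_test : bexp :=
  let dist (j : 'I_d) := ndist (coord j (var u)) (coord j (var v)) in
  BAnd (beq (nsum [seq npositive (dist j) | j <- enum 'I_d]) (NConst 1))
       (blt (nsum [seq dist j | j <- enum 'I_d]) (NConst omega)).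

Definition fill (a : nat) (b : bexp) : cmd :=
  for_loop u vertices
    (If b (NStore a (var u) (NConst 1)) (NStore a (var u) (NConst 0))).

Definition weigh (a r : nat) : cmd :=
  Seq (WStore r (NConst 0) WZero)
    (for_loop u vertices
      (If (member a (var u))
          (WStore r (NConst 0) (WAdd (WLoad r (NConst 0)) (WLoad 0 (var u))))
          Skip)).

Definition test_independent (a : nat) : cmd :=
  Seq (NStore flag (NConst 0) (NConst 1))
    (for_loop u vertices (for_loop v vertices
      (If (BAnd (BAnd (member a (var u)) (member a (var v))) edge_test)
          (NStore flag (NConst 0) (NConst 0)) Skip))).

Definition improve_cmd (a b : nat) : cmd :=
  Seq (test_independent a) (Seq (weigh a 1) (Seq (weigh b 2)
    (If (BAnd (member flag (NConst 0))
              (BNot (BWle (WLoad 1 (NConst 0)) (WLoad 2 (NConst 0)))))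
        (fill b (member a (var u))) Skip))).

(** The counter holds the index of the box in direction [j], a quotient by [k], and not a grid
    coordinate. *)
Definition corner (j : nat) : nat := scratch (5 + j).
Definition pick (i : nat) : nat := scratch (5 + d + i).
Definition corners : seq nat := [seq corner j | j <- iota 0 d].
Definition picks : seq nat := [seq pick i | i <- iota 0 (k ^ d)].

(** There is no division: [k * q + omega <= x < k * q + k] says that [x] has quotient [q] and
    remainder at least [omega]. *)
Definition box_test (shift : nat) : bexp :=
  bconj [seq BAnd
      (BNle (NAdd (nscale k (var (corner j))) (NConst omega))
            (NAdd (coord j (var u)) (NConst shift)))
      (blt (NAdd (coord j (var u)) (NConst shift))
           (NAdd (nscale k (var (corner j))) (NConst k)))
    | j : 'I_d <- enum 'I_d].

(** Picks may coincide or name no vertex, so [k ^ d] of them also describe every smaller set. *)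
Definition pick_test : bexp :=
  BNot (bconj [seq BNot (beq (var u) (var x)) | x <- picks]).

Definition exchange_cmd (shift : nat) : cmd :=
  Seq (fill candidate
        (bor (BAnd (BNot (box_test shift)) (member current (var u)))
             (BAnd pick_test (box_test shift))))
      (improve_cmd candidate current).

(** [current] restarts empty at each shift, while array 0 keeps the best set over the shifts so
    far. *)
Definition phase (shift : nat) : cmd :=
  Seq (fill current bfalse)
    (Seq (nest (corners ++ picks) loop_bound (exchange_cmd shift))
         (improve_cmd current 0)).

(** The shifts are unrolled into the program text, which depends on [d], [omega] and [k] only. *)
Definition los_mis : cmd :=
  foldr (fun shift => Seq (phase shift)) Skip (iota 0 k).

End Code.

(** * Correctness of the program *)

Section Correctness.
Variables (R : realType) (d n omega : nat) (G : wgraph R).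
Variable f : 'I_(nvert G) -> point d.
Hypothesis los : los_embedding n omega f.
Implicit Types (s : state R) (c : cmd).

Notation N := (nvert G).
Notation scratch := (scratch d).
Notation current := (scratch 0).
Notation candidate := (scratch 1).
Notation flag := (scratch 2).
Notation u := (scratch 3).
Notation v := (scratch 4).

(** The term [n ^ d] pays for the vertices, by [nvert_le], and [n + 1] for the box indices. *)
Definition loops_bound : {poly nat} := 'X^d + 'X + 1.

Notation wp := (wp loops_bound n).

Lemma loops_bound_ge : (N + (n + 1) <= loops_bound.[n])%N.
Proof.
rewrite /loops_bound !hornerD hornerXn hornerX hornerC addnA.
by rewrite !leq_add2r -[_ ^+ _]natrXE (nvert_le los).
Qed.

Lemma scratch_eq i j : (scratch i == scratch j) = (i == j).
Proof. by rewrite /scratch eqn_add2l. Qed.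

Definition writable (a : nat) : bool := (a == 0) || (d + 2 <= a)%N.

Lemma writable_scratch i : writable (scratch i).
Proof. by rewrite /writable leq_addr orbT. Qed.

Definition safe c : bool := all writable (nwrites c) && (0%N \notin wwrites c).

(** Only the instance has to stay intact: array 0 of naturals receives the output, and the weight
    arrays from 1 on are registers. *)
Definition input_kept s : Prop :=
  (forall a i, ~~ writable a -> nmem s a i = input_nmem n f a i) /\
  (forall i, wmem s 0 i = input_wmem G 0 i).

Lemma input_kept_frame c s s' :
  safe c -> frame c s s' -> input_kept s -> input_kept s'.
Proof.
move=> /andP[/allP sn sw] [fn fw] [kn kw]; split=> [a i ha|i].
  by rewrite fn ?kn //; apply: contra ha; apply: sn.
by rewrite fw.
Qed.

Definition members s a : {set 'I_N} := [set w : 'I_N | nmem s a w != 0%N].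

Lemma members_frame c s s' a :
  frame c s s' -> a \notin nwrites c -> members s' a = members s a.
Proof. by move=> [fn _] ha; apply/setP => w; rewrite !inE fn. Qed.

Lemma members_nset x i y s a : a != x -> members (nset x i y s) a = members s a.
Proof. by move=> ax; apply/setP => w; rewrite !inE nset_neq. Qed.

Lemma eval_vertices s : input_kept s -> neval s vertices = N.
Proof.
by case=> kn _; rewrite /= kn //= /writable /= -ltnNge addn2.
Qed.

Lemma eval_loop_bound s : input_kept s -> neval s loop_bound = (N + (n + 1))%N.
Proof.
by case=> kn _; rewrite /= !kn //= /writable /= -ltnNge addn2.
Qed.

Lemma eval_coord s (j : 'I_d) e (w : 'I_N) :
  input_kept s -> neval s e = w -> neval s (coord j e) = f w j.
Proof.
case=> kn _ /= ->; rewrite kn; last by rewrite /writable /= -ltnNge addn2 !ltnS.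
by rewrite /= !valK.
Qed.

Lemma eval_nsum s (T : Type) (r : seq T) (F : T -> nexp) :
  neval s (nsum [seq F x | x <- r]) = (\sum_(x <- r) neval s (F x))%N.
Proof. by elim: r => [|x r IH]; rewrite ?big_nil ?big_cons //= IH. Qed.

Lemma eval_nscale s m e : neval s (nscale m e) = (m * neval s e)%N.
Proof. by elim: m => //= m IH; rewrite /nscale /= in IH *; rewrite IH mulSn. Qed.

Lemma eval_bconj s (T : Type) (r : seq T) (F : T -> bexp) :
  beval s (bconj [seq F x | x <- r]) = all (fun x => beval s (F x)) r.
Proof. by elim: r => //= x r ->. Qed.

Lemma eval_beq s e1 e2 : beval s (beq e1 e2) = (neval s e1 == neval s e2).
Proof. by rewrite /= eqn_leq. Qed.

Lemma eval_member s a e : beval s (member a e) = (nmem s a (neval s e) != 0%N).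
Proof. by rewrite /= -ltnNge lt0n. Qed.

Lemma eval_edge_test s (x y : 'I_N) : input_kept s ->
  nmem s u 0 = x -> nmem s v 0 = y -> beval s (edge_test d omega) = edge x y.
Proof.
move=> ks hx hy; case: los => _ _ ->; rewrite /edge_test.
have ex : neval s (var u) = x by [].
have ey : neval s (var v) = y by [].
(* These conversions unfold one constructor at a time, so the sums keep the form that [eval_nsum]
   expects. *)
have -> b1 b2 : beval s (BAnd b1 b2) = beval s b1 && beval s b2 by [].
rewrite eval_beq /blt.
have -> b : beval s (BNot b) = ~~ beval s b by [].
have -> e1 e2 : beval s (BNle e1 e2) = (neval s e1 <= neval s e2)%N by [].
rewrite !eval_nsum -ltnNge !big_enum /=.
congr (_ && _).
  rewrite /line_of_sight -sum1_card; congr (_ == _); rewrite [RHS]big_mkcond /=.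
  apply: eq_bigr => j _; rewrite inE.
  have /= -> := eval_coord j ks ex; have /= -> := eval_coord j ks ey.
  by case: ltngtP => /=; lia.
congr (_ < _)%N; apply: eq_big => // j _.
have /= -> := eval_coord j ks ex; have /= -> := eval_coord j ks ey.
lia.
Qed.

Lemma wp_fill a b s (X : {set 'I_N}) :
  writable a -> a != u -> input_kept s ->
  (forall s' (w : 'I_N), input_kept s' -> frame (fill d a b) s s' ->
     nmem s' u 0 = w -> beval s' b = (w \in X)) ->
  wp (fill d a b) (fun s' => members s' a = X) s.
Proof.
move=> wa au ks hb.
have sf : safe (fill d a b) by rewrite /safe /= !writable_scratch wa.
pose I i s' := forall w : 'I_N, (w < i)%N -> (nmem s' a w != 0%N) = (w \in X).
apply: (@wp_imp _ _ _ _ (I N)); last first.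
  by move=> s' _ h; apply/setP => w; rewrite inE h.
apply: wp_for => //.
- by rewrite /= !inE !(eq_sym u) (negPf au).
- by apply: leq_trans loops_bound_ge; apply: leq_addr.
- by move=> s' fs; apply/eval_vertices/(input_kept_frame sf fs).
- by move=> i y s' h w hw; rewrite nset_neq ?h.
- move=> i s' hi fs xi hI.
  have hb' := hb s' (Ordinal hi) (input_kept_frame sf fs ks) fs xi.
  apply: wp_if; rewrite hb' => hX; apply: wp_nstore => w; rewrite ltnS leq_eqVlt.
  + case/orP => [/eqP wi | wi]; rewrite /= /update !eqxx /= xi.
      by rewrite wi eqxx (_ : w = Ordinal hi) ?hX //; exact: val_inj.
    by rewrite (ltn_eqF wi) hI.
  + case/orP => [/eqP wi | wi]; rewrite /= /update !eqxx /= xi.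
      rewrite wi eqxx (_ : w = Ordinal hi) ?(negPf hX) //; exact: val_inj.
    by rewrite (ltn_eqF wi) hI.
Qed.

Lemma wp_weigh a r s :
  a != u -> r != 0%N -> input_kept s ->
  wp (weigh d a r) (fun s' => wmem s' r 0 = set_weight (members s a)) s.
Proof.
move=> au r0 ks.
have sf : safe (weigh d a r) by rewrite /safe /= !writable_scratch /= !inE !(eq_sym 0%N) (negPf r0).
pose g i : R := if nmem s a i != 0%N then input_wmem G 0 i else 0.
pose I i s' := wmem s' r 0 = \sum_(0 <= j < i) g j.
apply: (@wp_seq _ _ _ _ _ (I 0%N)).
  by apply: wp_wstore; rewrite /I /= /update !eqxx big_geq.
move=> s1 f1 h1; apply: (@wp_imp _ _ _ _ (I N)); last first.
  move=> s' _ ->; rewrite big_mkord /set_weight [RHS]big_mkcond /=.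
  by apply: eq_bigr => w _; rewrite inE /g /= valK.
have tr s' : frame (for_loop u vertices
      (If (member a (var u))
          (WStore r (NConst 0) (WAdd (WLoad r (NConst 0)) (WLoad 0 (var u))))
          Skip)) s1 s' -> frame (weigh d a r) s s'.
  by move=> h; apply: frame_trans (frame_catl _ f1) (frame_catr _ h).
apply: wp_for => //.
- by apply: leq_trans loops_bound_ge; apply: leq_addr.
- by move=> s' /tr fs; apply/eval_vertices/(input_kept_frame sf fs).
- move=> i s' hi /tr fs xi hI; have [_ kw] := input_kept_frame sf fs ks.
  have ha j : nmem s' a j = nmem s a j.
    by case: fs => -> //=; rewrite !inE (negPf au).
  apply: wp_if; rewrite eval_member /= xi ha => hX.
    by apply: wp_wstore; rewrite /I /= /update !eqxx xi kw hI big_nat_recr //= /g hX.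
  by apply: wp_skip; rewrite /I hI big_nat_recr //= /g (negPf hX) addr0.
Qed.

Lemma wp_test_independent a s :
  a \notin [:: flag; u; v] -> input_kept s ->
  wp (test_independent d omega a)
    (fun s' => (nmem s' flag 0 != 0%N) = independent (members s a)) s.
Proof.
rewrite !inE !negb_or => /and3P[af au av] ks.
set c := test_independent _ _ _.
have sf : safe c by rewrite /safe /= !writable_scratch.
(* Stated on naturals, so that the two counters can be plugged in; false outside the vertices. *)
pose bad i j := [exists x : 'I_N, exists y : 'I_N,
  [&& val x == i, val y == j, x \in members s a, y \in members s a & edge x y]].
have badE (x y : 'I_N) :
    bad x y = [&& x \in members s a, y \in members s a & edge x y].
  apply/existsP/idP => [[x' /existsP[y']]|h].
    by case/and3P => /eqP/val_inj -> /eqP/val_inj ->.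
  by exists x; apply/existsP; exists y; rewrite !eqxx.
pose good i := all (fun j => ~~ bad i j) (iota 0 N).
pose I i s' := (nmem s' flag 0 != 0%N) = all good (iota 0 i).
apply: (@wp_seq _ _ _ _ _ (I 0%N)).
  by apply: wp_nstore; rewrite /I nset_eq.
move=> s1 f1 h1; apply: (@wp_imp _ _ _ _ (I N)); last first.
  move=> s' _ ->; apply/allP/independentP => [h x y hx hy | h i].
    have /allP/(_ y) : good x by apply: h; rewrite mem_iota /= add0n.
    by rewrite mem_iota /= add0n badE hx hy => /(_ (ltn_ord y)).
  rewrite mem_iota add0n => hi; apply/allP => j; rewrite mem_iota add0n => hj.
  rewrite -[i]/(val (Ordinal hi)) -[j]/(val (Ordinal hj)) badE.
  by apply/and3P => -[hx hy]; apply/negP/h.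
have iotaS i : iota 0 i.+1 = rcons (iota 0 i) i by rewrite -addn1 iotaD cats1.
have tr s' : frame (for_loop u vertices (for_loop v vertices
      (If (BAnd (BAnd (member a (var u)) (member a (var v))) (edge_test d omega))
          (NStore flag (NConst 0) (NConst 0)) Skip))) s1 s' -> frame c s s'.
  by move=> h; apply: frame_trans (frame_catl _ f1) (frame_catr _ h).
apply: wp_for => //.
- by rewrite /= !inE !scratch_eq.
- by apply: leq_trans loops_bound_ge; apply: leq_addr.
- by move=> s' /tr fs; apply/eval_vertices/(input_kept_frame sf fs).
- by move=> i y s' h; rewrite /I nset_neq ?scratch_eq.
move=> i s2 hi f2 xi hI.
(* Rows before [i] are complete, and row [i] is done for the columns below [m]. *)
pose J m s' := (nmem s' flag 0 != 0%N) =
  all good (iota 0 i) && all (fun j => ~~ bad i j) (iota 0 m).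
apply: (@wp_imp _ _ _ _ (J N)); last first.
  by move=> s' _; rewrite /I /J iotaS all_rcons andbC => ->.
have tr2 s' : frame (for_loop v vertices
      (If (BAnd (BAnd (member a (var u)) (member a (var v))) (edge_test d omega))
          (NStore flag (NConst 0) (NConst 0)) Skip)) s2 s' ->
    frame c s s' /\ nmem s' u 0 = i.
  move=> h; split; last by case: h => -> //=; rewrite !inE !scratch_eq.
  apply: tr; apply: frame_trans f2 _; apply: frame_sub h => b //=.
  by rewrite !inE => /or3P[] /eqP ->; rewrite eqxx ?orbT.
apply: wp_for => //.
- by rewrite /= !inE !scratch_eq.
- by apply: leq_trans loops_bound_ge; apply: leq_addr.
- by move=> s' /tr2[fs _]; apply/eval_vertices/(input_kept_frame sf fs).
- by move=> m y s' h; rewrite /J nset_neq ?scratch_eq.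
- by rewrite /J hI andbT.
move=> m s3 hm /tr2[f3 ui] vm hJ; have k3 := input_kept_frame sf f3 ks.
have ma w : (nmem s3 a w != 0%N) = (nmem s a w != 0%N).
  by case: f3 => -> //=; rewrite !inE (negPf af) (negPf au) (negPf av).
have hb : beval s3 (BAnd (BAnd (member a (var u)) (member a (var v)))
                         (edge_test d omega)) = bad i m.
  have -> b1 b2 : beval s3 (BAnd b1 b2) = beval s3 b1 && beval s3 b2 by [].
  have -> b1 b2 : beval s3 (BAnd b1 b2) = beval s3 b1 && beval s3 b2 by [].
  rewrite (@eval_edge_test _ (Ordinal hi) (Ordinal hm)) //.
  rewrite -[i in RHS]/(val (Ordinal hi)) -[m in RHS]/(val (Ordinal hm)) badE.
  by rewrite !eval_member /= ui vm !ma !inE andbA.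
apply: wp_if; rewrite hb => hbad.
  by apply: wp_nstore; rewrite /J nset_eq iotaS all_rcons hbad andbF.
by apply: wp_skip; rewrite /J iotaS all_rcons hbad.
Qed.

Lemma wp_improve_cmd a b s :
  a \notin [:: flag; u; v] -> b \notin [:: flag; u; v] -> writable b -> a != b ->
  input_kept s ->
  wp (improve_cmd d omega a b)
    (fun s' => members s' b = improve (members s a) (members s b)) s.
Proof.
move=> ha hb wb ab ks.
have [au bu] : a != u /\ b != u.
  by move: ha hb; rewrite !inE !negb_or => /and3P[_ -> _] /and3P[_ -> _].
apply: wp_seq (wp_test_independent ha ks) _ => s1 f1 e1.
have k1 : input_kept s1.
  by apply: input_kept_frame f1 ks; rewrite /safe /= !writable_scratch.
have m1 x : x \notin [:: flag; u; v] -> members s1 x = members s x.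
  by move=> hx; apply: members_frame f1 _ => /=; move: hx; rewrite !inE;
     do !case: eqP.
have {}m1 := (m1 a ha, m1 b hb).
apply: wp_seq (@wp_weigh a 1 s1 au isT k1) _ => s2 f2 e2.
have k2 : input_kept s2.
  by apply: input_kept_frame f2 k1; rewrite /safe /= !writable_scratch.
have m2 x : x != u -> members s2 x = members s1 x.
  by move=> hx; apply: members_frame f2 _ => /=; rewrite !inE negb_or hx.
have {}m2 := (m2 a au, m2 b bu).
apply: wp_seq (@wp_weigh b 2 s2 bu isT k2) _ => s3 f3 e3.
have k3 : input_kept s3.
  by apply: input_kept_frame f3 k2; rewrite /safe /= !writable_scratch.
have m3 x : x != u -> members s3 x = members s2 x.
  by move=> hx; apply: members_frame f3 _ => /=; rewrite !inE negb_or hx.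
have {}m3 := (m3 a au, m3 b bu).
have hc : beval s3 (BAnd (member flag (NConst 0))
     (BNot (BWle (WLoad 1 (NConst 0)) (WLoad 2 (NConst 0))))) =
   heavier (members s a) (members s b).
  have -> b1 b2 : beval s3 (BAnd b1 b2) = beval s3 b1 && beval s3 b2 by [].
  (* The second weighing leaves weight array 1 alone, and neither weighing touches the flag. *)
  rewrite eval_member /= e3 (proj2 f3) //= e2 m2 !m1 -ltNge /heavier -e1.
  by rewrite (proj1 f3) ?(proj1 f2) //= !inE !scratch_eq.
rewrite /improve; apply: wp_if; rewrite hc => h.
  rewrite h -m1.1 -m2.1 -m3.1; apply: wp_fill => // s' w _ fs uw.
  rewrite eval_member /= uw inE; case: fs => -> //=.
  by rewrite !inE (negPf au) (negPf ab).
by rewrite (negPf h); apply: wp_skip; rewrite m3 m2 m1.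
Qed.

Variable k : nat.
Hypothesis k_gt0 : (0 < k)%N.

Notation box := (box omega f k).
Notation kept := (kept omega f k).

Lemma eval_box_test s shift (w : 'I_N) (q : point d) :
  input_kept s -> nmem s u 0 = w ->
  (forall j : 'I_d, nmem s (corner d j) 0 = q j) ->
  beval s (box_test d omega k shift) = (w \in box shift q).
Proof.
move=> ks hw hq; rewrite /box_test eval_bconj !inE.
have test (j : 'I_d) : beval s (BAnd
      (BNle (NAdd (nscale k (var (corner d j))) (NConst omega))
            (NAdd (coord j (var u)) (NConst shift)))
      (blt (NAdd (coord j (var u)) (NConst shift))
           (NAdd (nscale k (var (corner d j))) (NConst k)))) =
    (omega <= (f w j + shift) %% k)%N && ((f w j + shift) %/ k == q j)%N.
  have ew : neval s (var u) = w by [].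
  have /= ec := eval_coord j ks ew.
  rewrite /= eval_nscale /= ec hq -ltnNge.
  move: (f w j + shift)%N (q j) => x m; have := ltn_pmod x k_gt0.
  have := divn_eq x k; move: (x %/ k)%N (x %% k)%N => a b -> bk.
  apply/idP/idP => [/andP[h1 h2] | /andP[h1 /eqP <-]].
    have am : (a < m.+1)%N by rewrite -(@ltn_pmul2r k) // mulSn; lia.
    have ma : (m < a.+1)%N by rewrite -(@ltn_pmul2r k) // mulSn; lia.
    have e : a = m by lia.
    by rewrite e eqxx andbT in h1 *; lia.
  by apply/andP; split; nia.
apply/allP/andP => [h | [/forallP h1 /eqP h2] j _].
  have {}h j := h j (mem_enum _ _); split.
    by apply/forallP => j; have := h j; rewrite test => /andP[].
  by apply/eqP/ffunP => j; rewrite ffunE; have := h j; rewrite test => /andP[_ /eqP].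
by rewrite test h1 /= -h2 ffunE.
Qed.

Lemma eval_pick_test s (w : 'I_N) : nmem s u 0 = w ->
  beval s (pick_test d k) = (val w \in [seq nmem s x 0 | x <- picks d k]).
Proof.
move=> hw; rewrite /pick_test.
have -> b : beval s (BNot b) = ~~ beval s b by [].
rewrite eval_bconj -has_predC; apply/hasP/mapP => -[x hx].
  rewrite /= negbK -eqn_leq hw => /eqP ->; by exists x.
by move=> e; exists x => //=; rewrite negbK -eqn_leq hw e.
Qed.

Notation loop_vars := (corners d ++ picks d k).

Definition values s (xs : seq nat) : seq nat := [seq nmem s x 0 | x <- xs].

(** A tuple of counter values lists the [d] box indices and then the picks; in [picked], entries
    that are no vertex drop out. *)
Definition corner_of (vs : seq nat) : point d := [ffun j : 'I_d => nth 0%N vs j].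
Definition picked (vs : seq nat) : {set 'I_N} := [set w | val w \in drop d vs].

(** The counters fill consecutive arrays from [scratch 5] on, hence are distinct and avoid the five
    working arrays. *)
Lemma loop_varsE : loop_vars = [seq scratch i | i <- iota 5 (d + k ^ d)].
Proof.
have e m r : iota m r = [seq m + i | i <- iota 0 r]%N by rewrite -iotaDl addn0.
by rewrite iotaD map_cat (e 5) (e (5 + d)%N) -!map_comp.
Qed.

Lemma loop_vars_scratch i : (i < 5)%N -> scratch i \notin loop_vars.
Proof.
move=> hi; rewrite loop_varsE; apply/mapP => -[j]; rewrite mem_iota => /andP[h _].
by move/eqP; rewrite scratch_eq => /eqP e; rewrite -e leqNgt hi in h.
Qed.

Lemma writable_loop_vars x : x \in loop_vars -> writable x.
Proof. by rewrite loop_varsE => /mapP[i _ ->]; apply: writable_scratch. Qed.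

Lemma loop_vars_uniq : uniq loop_vars.
Proof.
rewrite loop_varsE map_inj_uniq ?iota_uniq // => i j /eqP.
by rewrite scratch_eq => /eqP.
Qed.

Lemma nwrites_exchange_cmd shift :
  {subset nwrites (exchange_cmd d omega k shift)
     <= [seq scratch i | i <- iota 0 5]}.
Proof.
by move=> x; rewrite /= !inE; repeat (case/orP => [/eqP -> |]);
  rewrite ?eqxx ?orbT // => /eqP ->; rewrite eqxx ?orbT.
Qed.

Lemma loop_vars_nwrites shift x :
  x \in loop_vars -> x \notin nwrites (exchange_cmd d omega k shift).
Proof.
move=> hx; apply: contraL hx => /nwrites_exchange_cmd/mapP[i].
by rewrite mem_iota => /andP[_ hi] ->; apply: loop_vars_scratch.
Qed.

Lemma safe_exchange_cmd shift : safe (exchange_cmd d omega k shift).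
Proof.
rewrite /safe; apply/andP; split=> //.
apply/allP => x /nwrites_exchange_cmd/mapP[i _ ->]; exact: writable_scratch.
Qed.

Lemma wp_exchange_cmd shift s (D := members s current)
    (vs := values s loop_vars) :
  input_kept s ->
  wp (exchange_cmd d omega k shift)
    (fun s' => members s' current =
       improve (exchange omega f k shift (corner_of vs) (picked vs) D) D) s.
Proof.
move=> ks; set S := exchange _ _ _ _ _ _ _.
apply: (@wp_seq _ _ _ _ _ (fun s' => members s' candidate = S)).
  apply: wp_fill => //; rewrite ?scratch_eq ?writable_scratch //.
  move=> s' w k' fs hw.
  (* The body writes no loop counter, so all of them keep their initial values during [fill]. *)
  have hv x : x \in loop_vars -> nmem s' x 0 = nmem s x 0.
    move=> hx; have [-> //]  := frame_catl (improve_cmd d omega candidate current) fs.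
    exact: (loop_vars_nwrites shift hx).
  have hbox : beval s' (box_test d omega k shift) = (w \in box shift (corner_of vs)).
    apply: eval_box_test => // j; rewrite ffunE /vs /values.
    have jd : (j < size (corners d))%N by rewrite size_map size_iota.
    rewrite map_cat nth_cat size_map jd (nth_map 0%N) //.
    rewrite /corners (nth_map 0%N) ?size_iota // nth_iota // add0n.
    apply: hv; rewrite mem_cat; apply/orP; left; apply: map_f.
    by rewrite mem_iota add0n ltn_ord.
  have hpick : beval s' (pick_test d k) = (w \in picked vs).
    rewrite (eval_pick_test hw) inE /vs /values map_cat drop_size_cat; last first.
      by rewrite !size_map size_iota.
    congr (_ \in _); rewrite (_ : map _ _ = values s (picks d k)) //.
    by apply/eq_in_map => x hx; apply: hv; rewrite mem_cat hx orbT.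
  have hcur : beval s' (member current (var u)) = (w \in D).
    rewrite eval_member /= hw inE; case: fs => -> //=.
    by rewrite !inE !scratch_eq.
  have -> b1 b2 : beval s' (bor b1 b2) = beval s' b1 || beval s' b2.
    by rewrite /= negb_and !negbK.
  have -> b1 b2 : beval s' (BAnd b1 b2) = beval s' b1 && beval s' b2 by [].
  have -> b1 b2 : beval s' (BAnd b1 b2) = beval s' b1 && beval s' b2 by [].
  have -> b : beval s' (BNot b) = ~~ beval s' b by [].
  by rewrite hbox hpick hcur in_setU in_setD in_setI.
move=> s1 f1 e1.
have -> : D = members s1 current.
  rewrite (members_frame f1) //=; rewrite !inE !scratch_eq //.
rewrite -e1; apply: wp_improve_cmd; rewrite ?inE ?scratch_eq ?writable_scratch //.
by apply: input_kept_frame f1 ks; rewrite /safe /= !writable_scratch.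
Qed.

Lemma nwrites_nest xs e c x :
  (x \in nwrites (nest xs e c)) = (x \in xs) || (x \in nwrites c).
Proof.
elim: xs => //= y xs IH; rewrite !inE mem_cat IH !inE.
by case: (x == y); rewrite /= ?orbT ?orbF.
Qed.

Lemma wwrites_nest xs e c : wwrites (nest xs e c) = wwrites c.
Proof. by elim: xs => //= y xs ->; rewrite cats0. Qed.

Lemma safe_nest xs e c : {in xs, forall x, writable x} -> safe c ->
  safe (nest xs e c).
Proof.
move=> hxs /andP[/allP hc hw]; rewrite /safe wwrites_nest hw andbT.
by apply/allP => x; rewrite nwrites_nest => /orP[/hxs|/hc].
Qed.

(** * Exhaustive search by nested loops *)

Section Nest.
Variables (c : cmd) (a : nat) (P : {set 'I_N} -> Prop).
Variables (L : {set 'I_N} -> {set 'I_N} -> Prop) (C : seq nat -> {set 'I_N} -> Prop).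
Hypothesis safe_c : safe c.
Hypothesis L_refl : forall D, L D D.
Hypothesis L_trans : forall D1 D2 D3, L D1 D2 -> L D2 D3 -> L D1 D3.
Hypothesis C_mono : forall vs D1 D2, L D1 D2 -> C vs D1 -> C vs D2.

(** [C vs] is what the body achieves for the tuple [vs]; later turns only move up along [L], so by
    [C_mono] it still holds at the end, for all tuples at once. The list [ys] collects the counters
    of the enclosing loops and lets the induction on [xs] go through. *)
Lemma wp_nest ys xs s :
  uniq (ys ++ xs) -> a \notin xs ->
  {in xs, forall x, writable x} ->
  {in ys ++ xs, forall x, x \notin nwrites c} ->
  (forall s', input_kept s' -> P (members s' a) ->
     wp c (fun s'' => [/\ P (members s'' a), L (members s' a) (members s'' a) &
                          C (values s' (ys ++ xs)) (members s'' a)]) s') ->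
  input_kept s -> P (members s a) ->
  wp (nest xs loop_bound c)
    (fun s' => [/\ P (members s' a), L (members s a) (members s' a) &
       forall vs, size vs = size xs -> all (fun i => i < N + (n + 1))%N vs ->
         C (values s ys ++ vs) (members s' a)]) s.
Proof.
elim: xs ys s => [|x xs IH] ys s.
  move=> _ _ _ _ hc ks hP; apply: wp_imp (hc _ ks hP) _ => s' _.
  by rewrite cats0 => -[hP' hL hC]; split=> // -[|//] _; rewrite cats0.
move=> yxs; rewrite inE negb_or => /andP[ax axs] hw hnw hc ks hP.
have wxs : {in xs, forall y, writable y}.
  by move=> y hy; apply: hw; rewrite inE hy orbT.
have sf : safe (nest (x :: xs) loop_bound c) by apply: safe_nest.
have xc : x \notin nwrites (nest xs loop_bound c).
  rewrite nwrites_nest negb_or hnw ?mem_cat ?mem_head ?orbT // andbT.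
  by move: yxs; rewrite cat_uniq => /and3P[_ _ /= /andP[]].
(* All tuples that extend the outer values by a first entry below [i] have been tried. *)
pose I i s' := [/\ P (members s' a), L (members s a) (members s' a) &
  forall j vs, (j < i)%N -> size vs = size xs ->
    all (fun i => i < N + (n + 1))%N vs ->
    C (values s ys ++ j :: vs) (members s' a)].
apply: (@wp_imp _ _ _ _ (I (N + (n + 1))%N)); last first.
  move=> s' _ [hP' hL hC]; split=> // -[//|j vs] [hs] /= /andP[hj hvs].
  exact: hC.
apply: wp_for => //.
- exact: loops_bound_ge.
- by move=> s' fs; apply/eval_loop_bound/(input_kept_frame sf fs).
- by move=> i y s' [? ? ?]; split; rewrite !members_nset.
move=> i s1 hi f1 xi [hP1 hL1 hC1].
have vys : values s1 ys = values s ys.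
  apply/eq_in_map => y hy; case: f1 => -> //.
  rewrite -[for_loop _ _ _]/(nest (x :: xs) loop_bound c) nwrites_nest negb_or.
  rewrite hnw ?mem_cat ?hy // andbT.
  by move: yxs; rewrite uniq_catC cat_uniq => /and3P[_ /hasPn/(_ y hy) h _].
have := IH (rcons ys x) s1; rewrite cat_rcons => {}IH.
apply: wp_imp (IH yxs axs wxs hnw hc (input_kept_frame sf f1 ks) hP1) _.
move=> s2 _ [hP2 hL2 hC2]; split=> //; first exact: L_trans hL1 hL2.
move=> j vs; rewrite ltnS leq_eqVlt => /orP[/eqP -> | ji] hs hvs.
  have := hC2 _ hs hvs; rewrite /values map_rcons cat_rcons -/(values s1 ys) vys xi.
  by [].
by apply: C_mono hL2 _; apply: hC1.
Qed.

End Nest.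

(** Conditional on independence, because the program rejects dependent choices. This is the [C] of
    [wp_nest]. *)
Definition box_optimal shift (vs : seq nat) (D : {set 'I_N}) : Prop :=
  independent (picked vs :&: box shift (corner_of vs)) ->
  set_weight (picked vs :&: box shift (corner_of vs))
    <= set_weight (D :&: box shift (corner_of vs)).

(** This makes the search exhaustive: by [box_card], the [k ^ d] picks have room for all of [T]. *)
Lemma box_tuple shift (q : point d) (T : {set 'I_N}) :
  (forall j, q j < n.+1)%N -> T \subset box shift q ->
  exists vs, [/\ size vs = size loop_vars, all (fun i => i < N + (n + 1))%N vs,
    corner_of vs = q & picked vs = T].
Proof.
move=> hq hT; set K := (k ^ d)%N.
have hK : (#|T| <= K)%N := leq_trans (subset_leq_card hT) (box_card los shift k_gt0 q).
pose us := [seq q j | j <- enum 'I_d].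
(* The tuple is padded with the number of vertices, which is not a vertex. *)
pose ts := [seq val w | w <- enum T] ++ nseq (K - #|T|) N.
have su : size us = d by rewrite size_map size_enum_ord.
exists (us ++ ts); split.
- rewrite !size_cat su !size_map !size_iota size_nseq -cardE.
  by congr (_ + _)%N; rewrite subnKC.
- rewrite !all_cat; apply/and3P; split.
  + apply/allP => x /mapP[j _ ->]; apply: leq_trans (hq j) _.
    by rewrite addn1 leq_addl.
  + by apply/allP => x /mapP[w _ ->]; apply: leq_trans (ltn_ord w) (leq_addr _ _).
  + by apply/allP => x /nseqP[-> _]; rewrite addn1 addnS ltnS leq_addr.
- apply/ffunP => j; rewrite ffunE nth_cat su ltn_ord (nth_map j) ?size_enum_ord //.
  by rewrite nth_ord_enum.
- apply/setP => w; rewrite inE drop_size_cat // mem_cat (mem_map val_inj) mem_enum.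
  case: (w \in T) => //=; apply/negbTE/nseqP => -[e _].
  by have := ltn_ord w; rewrite /= e ltnn.
Qed.

Lemma safe_seq c1 c2 : safe c1 -> safe c2 -> safe (Seq c1 c2).
Proof.
by rewrite /safe /= all_cat mem_cat negb_or => /andP[-> ->] /andP[-> ->].
Qed.

Lemma safe_phase shift : safe (phase d omega k shift).
Proof.
apply: safe_seq; first by rewrite /safe /= !writable_scratch.
apply: safe_seq; first exact: safe_nest writable_loop_vars (safe_exchange_cmd _).
by rewrite /safe /= !writable_scratch.
Qed.

Lemma wp_phase shift s : (shift < k)%N -> input_kept s ->
  independent (members s 0) ->
  wp (phase d omega k shift)
    (fun s' => [/\ independent (members s' 0),
       set_weight (members s 0) <= set_weight (members s' 0) &
       forall T, independent T ->
         set_weight (T :&: kept shift) <= set_weight (members s' 0)]) s.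
Proof.
move=> sk ks iS.
have n0 i : scratch i == 0%N = false by rewrite /scratch addn2.
have z0 i : 0%N == scratch i = false by rewrite eq_sym n0.
pose P (D : {set 'I_N}) := D \subset kept shift /\ independent D.
apply: (@wp_seq _ _ _ _ _ (fun s' => members s' current = set0)).
  apply: wp_fill; rewrite ?writable_scratch ?scratch_eq // => s' w _ _ _.
  by rewrite inE.
move=> s1 f1 e1.
have k1 : input_kept s1.
  by apply: input_kept_frame f1 ks; rewrite /safe /= !writable_scratch.
have o1 : members s1 0 = members s 0.
  by apply: members_frame f1 _; rewrite /= !inE !z0.
have P1 : P (members s1 current) by rewrite e1; split; rewrite ?sub0set ?independent0.
pose L := boxwise_le omega f k shift.
pose Q s' := [/\ P (members s' current), L (members s1 current) (members s' current) &
  forall vs, size vs = size loop_vars -> all (fun i => i < N + (n + 1))%N vs ->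
    box_optimal shift vs (members s' current)].
apply: (@wp_seq _ _ _ _ _ Q).
  apply: (@wp_nest _ _ P L (box_optimal shift) _ _ _ _ [::]) => //.
  - exact: safe_exchange_cmd.
  - by move=> D q.
  - by move=> D1 D2 D3 h1 h2 q; apply: le_trans (h1 q) (h2 q).
  - by move=> vs D1 D2 h hD iX; apply: le_trans (h _); apply: hD.
  - exact: loop_vars_uniq.
  - exact: loop_vars_scratch.
  - exact: writable_loop_vars.
  - exact: loop_vars_nwrites.
  move=> s' k' [kD iD]; apply: wp_imp (wp_exchange_cmd shift k') _ => s'' _ ->.
  rewrite cat0s; split.
  + split; last exact: improve_independent.
    by rewrite /improve; case: ifP => // _; apply: exchange_sub.
  + exact: boxwise_improve.
  + by move=> iX; apply: (improve_box los).
move=> s2 f2 [[kD iD] _ opt].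
have o2 : members s2 0 = members s1 0.
  apply: members_frame f2 _; rewrite nwrites_nest negb_or; apply/andP; split.
    by rewrite loop_varsE; apply/mapP => -[i _ /eqP]; rewrite z0.
  by apply/negP => /nwrites_exchange_cmd/mapP[i _ /eqP]; rewrite z0.
have k2 : input_kept s2.
  apply: input_kept_frame f2 k1; apply: safe_nest (safe_exchange_cmd _).
  exact: writable_loop_vars.
have ha : current \notin [:: flag; u; v] by rewrite !inE !scratch_eq.
have hb : 0%N \notin [:: flag; u; v] by rewrite !inE !z0.
apply: wp_imp (wp_improve_cmd ha hb isT (negbT (n0 0)) k2) _ => s3 _ ->.
rewrite -o1 -o2; split.
- by apply: improve_independent; rewrite o2 o1.
- exact: improve_geT.
(* The final set weighs at least as much as [current], which is now compared with the kept part of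
   [T] box by box. *)
move=> T iT; apply: le_trans (improve_geS _ iD).
apply: (boxwise_le_weight los k_gt0 sk) => //; first exact: subsetIr.
move=> q; set X := _ :&: box shift q.
(* A vertex of [X] is needed to bound the indices of [q] through [block_le]; without one, the weight
   is 0. *)
have [-> | /set0Pn[w]] := eqVneq X set0.
  by rewrite {1}/set_weight big_set0 set_weight_ge0.
rewrite in_setI => /andP[_]; rewrite inE => /andP[_ /eqP hq].
have [|vs [sv av cv pv]] := @box_tuple shift q X _ (subsetIr _ _).
  by move=> j; rewrite -hq; apply: (block_le los).
have := opt vs sv av; rewrite /box_optimal cv pv {1 2}/X -setIA setIid; apply.
by apply: independent_sub iT; rewrite -setIA subsetIl.
Qed.

(** No phase decreases the weight in array 0, so the guarantee for each shift persists through the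
    later phases. *)
Lemma wp_los_mis s : input_kept s -> members s 0 = set0 ->
  wp (los_mis d omega k)
    (fun s' => independent (members s' 0) /\
       forall shift T, (shift < k)%N -> independent T ->
         set_weight (T :&: kept shift) <= set_weight (members s' 0)) s.
Proof.
move=> ks s0; have iS : independent (members s 0) by rewrite s0 independent0.
pose Q (r : seq nat) s' := [/\ independent (members s' 0),
  set_weight (members s 0) <= set_weight (members s' 0) &
  forall shift T, shift \in r -> independent T ->
    set_weight (T :&: kept shift) <= set_weight (members s' 0)].
apply: (@wp_imp _ _ _ _ (Q (iota 0 k))); last first.
  move=> s' _ [iS' _ h]; split=> // shift T sk; apply: h.
  by rewrite mem_iota.
have : {in iota 0 k, forall i, i < k}%N by move=> i; rewrite mem_iota.
rewrite /los_mis {}/Q; elim: (iota 0 k) s ks iS {s0} => [|i r IH] s ks iS hr /=.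
  by apply: wp_skip; split.
have ik := hr i (mem_head _ _).
apply: wp_seq (wp_phase ik ks iS) _ => s1 f1 [i1 w1 h1].
have k1 : input_kept s1.
  exact: input_kept_frame (safe_phase i) f1 ks.
apply: wp_imp (IH s1 k1 i1 _) _ => [j jr|s2 _ [i2 w2 h2]].
  by apply: hr; rewrite inE jr orbT.
split=> //; first exact: le_trans w1 w2.
move=> shift T; rewrite inE => /orP[/eqP -> iT | sr]; last exact: h2.
exact: le_trans (h1 _ iT) w2.
Qed.

End Correctness.

Theorem theorem8 (R : realType) (d omega : nat)
    (hd : (2 <= d)%N) (homega : (2 < omega)%N) (eps : R) (heps : 0 < eps) :
  exists (c : cmd) (p : {poly nat}),
    forall (n : nat) (G : wgraph R) (f : 'I_(nvert G) -> point d),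
      los_embedding n omega f ->
      exists (t : nat) (s : state R),
        [/\ exec c (input_state n f) t s,
            (t <= p.[n])%N &
            mis_approx eps (output_set G s)].
Proof.
(* The Archimedean bound brings [d * omega / k] down to [eps / (1 + eps)], and the successor makes
   [k] positive. Neither [n] nor the network enters, so the program is fixed before its input. *)
pose k := (Num.bound ((d * omega)%:R * (1 + eps) / eps)).+1.
have hk : (d * omega)%:R * (1 + eps) <= k%:R * eps.
  rewrite -ler_pdivrMr //; apply/ltW; apply: lt_le_trans (archi_boundP _) _.
    by rewrite !mulr_ge0 ?invr_ge0 ?addr_ge0 ?ler0n ?ltW.
  by rewrite ler_nat.
exists (los_mis d omega k), (time_bound (loops_bound d) (los_mis d omega k)).
move=> n G f los.
have s0 : members G (input_state n f) 0 = set0.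
  by apply/setP => w; rewrite !inE.
have ks : input_kept n f (input_state n f) by [].
have [t [s [run ht [iS hS]]]] := wp_los_mis los (k := k) isT ks s0.
exists t, s; split=> //.
by apply: (shifts_approx _ heps hk iS) => // shift T sk; apply: hS.
Qed.
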